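(* Let $G$ be a connected graph and $E^*$ a set of edges of $G$. Suppose that (i) $r_0=\ell_G(E^* )$ is even; and (ii) there is a way to assign an orientation $\overrightarrow{e}$ to each edge $e\in E^*$ such that the directed edges in $\overrightarrow{E^*}=\{\overrightarrow{e}:e\in E^*\}$ are balanced on every cycle $C$ of $G$ with $|E(C)|<r_0$. Then $G$ belongs to $DP_<$.
   Context: All graphs are finite and simple. For a graph $G$ and $m\in\mathbb{N}$, a cover of $G$ is a pair $\mathcal{H}=(L,H)$ where $H$ is a graph and $L$ maps each vertex of $G$ to a subset of $V(H)$ such that: $\{L(u):u\in V(G)\}$ partitions $V(H)$; each $H[L(u)]$ is complete; if $u,v$ are non-adjacent in $G$ there are no edges of $H$ between $L(u)$ and $L(v)$; for each edge $uv\in E(G)$ the edges of $H$ between $L(u)$ and $L(v)$ form a matching. It is $m$-fold if $|L(v)|=m$ for all $v$. An $\mathcal{H}$-coloring is an independent set of $H$ of size $|V(G)|$; $P_{DP}(G,\mathcal{H})$ is their number, and the DP color function $P_{DP}(G,m)$ is the minimum of $P_{DP}(G,\mathcal{H})$ over all $m$-fold covers $\mathcal{H}$ of $G$. $P(G,m)$ is the chromatic polynomial. $DP_<$ is the set of graphs $G$ for which there is an integer $M$ with $P_{DP}(G,m)<P(G,m)$ for all integers $m\ge M$. For $E_0\subseteq E(G)$, the girth $\ell_G(E_0)$ is the minimum length of a cycle $C$ in $G$ with $|E(C)\cap E_0|$ odd, and $\ell_G(E_0)=\infty$ if no such cycle exists. Given orientations of the edges of $E^*$ (only edges of $E^*$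 are oriented), the directed edges of $\overrightarrow{E^*}$ are balanced on a cycle $C$ if $|E(C)\cap E^*|$ is even and exactly half of the edges in $E(C)\cap E^*$ are oriented in the same direction as a fixed traversal direction of $C$ (e.g. clockwise); otherwise they are unbalanced on $C$. (In particular they are balanced on $C$ if $E(C)\cap E^*=\emptyset$.) *)

(* Defs.v *)
From mathcomp Require Import all_boot.
From mathcomp Require Import boolp.

Set Implicit Arguments.
Unset Strict Implicit.
Unset Printing Implicit Defensive.

Record sgraph := SGraph {
  svertex :> finType;
  adj : rel svertex;
  adj_sym : symmetric adj;
  adj_irrefl : irreflexive adj }.

Definition edges (G : sgraph) : {set {set G}} :=
  [set [set p.1; p.2] | p : G * G & adj p.1 p.2].

Definition connected (G : sgraph) : Prop :=
  0 < #|G| /\ forall x y : G, connect (@adj G) x y.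

Definition independent (G : sgraph) (I : {set G}) : bool :=
  [forall x in I, forall y in I, ~~ adj x y].

(** ** Cycles *)

(** A cycle is given by its vertices listed in the order of a traversal, so
    each cycle subgraph is represented once for every choice of a starting
    vertex and of a direction. *)
Definition is_cycle (G : sgraph) (c : seq G) : bool :=
  (2 < size c) && ucycleb (@adj G) c.

Definition cycle_edges (G : sgraph) (c : seq G) : {set {set G}} :=
  [set [set x; next c x] | x in c].

Definition odd_cycle_length (G : sgraph) (E0 : {set {set G}}) (k : nat) : bool :=
  [exists c : k.-tuple G, is_cycle c && odd #|cycle_edges c :&: E0|].

(** [None] stands for the value infinity. *)
Definition girth (G : sgraph) (E0 : {set {set G}}) : option nat :=
  match pselect (exists k, odd_cycle_length E0 k) with
  | left ex_k => Some (ex_minn ex_k)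
  | right _ => None
  end.

(** [o e = (x, y)] means that the edge [e] is directed from [x] to [y]; the
    values of [o] outside [E] are irrelevant. *)
Definition orientation (G : sgraph) (E : {set {set G}})
    (o : {set G} -> G * G) : Prop :=
  forall e, e \in E -> [set (o e).1; (o e).2] = e.

Definition forward_edges (G : sgraph) (E : {set {set G}})
    (o : {set G} -> G * G) (c : seq G) : {set {set G}} :=
  [set e in cycle_edges c :&: E | [exists x in c, o e == (x, next c x)]].

Definition balanced (G : sgraph) (E : {set {set G}})
    (o : {set G} -> G * G) (c : seq G) : bool :=
  ~~ odd #|cycle_edges c :&: E| &&
  (#|forward_edges E o c| == #|cycle_edges c :&: E|./2).

(** ** Chromatic polynomial *)

Definition proper_coloring (G : sgraph) (m : nat) (f : {ffun G -> 'I_m}) : bool :=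
  [forall x, forall y, adj x y ==> (f x != f y)].

(** Value of the chromatic polynomial of [G] at the natural number [m]. *)
Definition chromatic_poly (G : sgraph) (m : nat) : nat :=
  #|[set f : {ffun G -> 'I_m} | proper_coloring f]|.

(** ** DP colorings *)

Definition edges_between (H : sgraph) (A B : {set H}) : {set {set H}} :=
  [set [set p.1; p.2] | p : H * H & [&& p.1 \in A, p.2 \in B & adj p.1 p.2]].

(** [trivIset], i.e. pairwise disjointness of the edges, is the matching
    condition. The sets [L u] partition [H] as an indexed family. *)
Record is_cover (G H : sgraph) (L : G -> {set H}) : Prop := IsCover {
  cover_partition : forall x : H, exists! u : G, x \in L u;
  cover_complete : forall (u : G) (x y : H),
    x \in L u -> y \in L u -> x != y -> adj x y;
  cover_nonadj : forall u v : G,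
    u != v -> ~~ adj u v -> edges_between (L u) (L v) = set0;
  cover_matching : forall u v : G,
    adj u v -> trivIset (edges_between (L u) (L v)) }.

Definition is_fold_cover (m : nat) (G H : sgraph) (L : G -> {set H}) : Prop :=
  is_cover L /\ forall u : G, #|L u| = m.

(** [L] does not occur in the count: an [(L, H)]-coloring only refers to [H]. *)
Definition num_cover_colorings (G H : sgraph) : nat :=
  #|[set I : {set H} | independent I && (#|I| == #|G|)]|.

Definition cover_coloring_count (G : sgraph) (m n : nat) : bool :=
  `[< exists (H : sgraph) (L : G -> {set H}),
        is_fold_cover m L /\ num_cover_colorings G H = n >].

Section FibreCover.
Variables (G : sgraph) (m : nat).

Definition fibre_adj : rel (G * 'I_m) := fun p q => (p.1 == q.1) && (p != q).

Fact fibre_adj_sym : symmetric fibre_adj.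
Proof. by move=> p q; rewrite /fibre_adj eq_sym [p == q]eq_sym. Qed.

Fact fibre_adj_irrefl : irreflexive fibre_adj.
Proof. by move=> p; rewrite /fibre_adj !eqxx. Qed.

Definition fibre_graph : sgraph := SGraph fibre_adj_sym fibre_adj_irrefl.

Definition fibre (u : G) : {set fibre_graph} :=
  [set p : G * 'I_m | p.1 == u].

Lemma fibre_fold_cover : is_fold_cover m fibre.
Proof.
have no_edge u v : u != v -> edges_between (fibre u) (fibre v) = set0.
  move=> neq_uv; apply/setP => E; rewrite inE; apply/negP => /imsetP[[p q]].
  rewrite inE /= !inE => /and3P[/eqP pu /eqP qv /andP[/eqP pq _]] _.
  by move: neq_uv; rewrite -pu -qv pq eqxx.
split; first split.
- move=> x; exists x.1; split; first by rewrite inE.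
  by move=> u; rewrite inE => /eqP.
- by move=> u x y; rewrite !inE => /eqP xu /eqP yu neq_xy;
    rewrite /adj /= /fibre_adj xu yu eqxx.
- by move=> u v neq_uv _; apply: no_edge.
- move=> u v adj_uv; rewrite no_edge; first by apply/trivIsetP => A B; rewrite inE.
  by apply/eqP => uv; move: adj_uv; rewrite uv adj_irrefl.
- move=> u; have -> : fibre u = setX [set u] [set: 'I_m].
    by apply/setP => -[v i]; rewrite !inE /= andbT.
  by rewrite cardsX cards1 cardsT card_ord mul1n.
Qed.

End FibreCover.

Lemma cover_coloring_count_ex (G : sgraph) (m : nat) :
  exists n, cover_coloring_count G m n.
Proof.
exists (num_cover_colorings G (fibre_graph G m)); apply/asboolP.
by exists (fibre_graph G m), (@fibre G m); split; first exact: fibre_fold_cover.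
Qed.

Definition dp_color_function (G : sgraph) (m : nat) : nat :=
  ex_minn (cover_coloring_count_ex G m).

Definition DP_lt (G : sgraph) : Prop :=
  exists M : nat, forall m : nat, M <= m ->
    dp_color_function G m < chromatic_poly G m.

(* Main.v *)
Require Import Defs.
From mathcomp Require Import all_boot.
From mathcomp Require Import order ssralg ssrnum ssrint finalg zmodp zify.
From mathcomp Require Import boolp.

(** Let [s x y] be [1] or [-1] along or against an oriented edge of [E] and [0]
    on the other edges, and take the [m]-fold cover in which [(x, i)] is joined
    to [(y, i + s x y)], second components being taken modulo [m]. Its colorings
    are the maps [f] with [f y <> f x + s x y] for every edge [xy]. Expand both
    this number and [P(G, m)] by inclusion-exclusion over the sets [A] of edges
    on which equality is imposed. When the system on [A] is solvable it has as
    many solutions as the homogeneous one, so [P(G, m) - P_DP(G, H)] is the sum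
    of [(-1)^|A| m^(c(A))] over the [A] with an unsolvable system, [c(A)] being
    the number of components of [A]. Such an [A] contains a cycle on which [s]
    has a nonzero sum; the shortest one is induced in [A] and, by the balance
    condition, has length at least [r0]. As [r0] is even, if [|A|] is odd then
    either this cycle is longer than [r0] or [A] has an edge leaving it, so
    [c(A) <= n - r0]. A cycle of length [r0] with an odd number of edges in [E]
    gives the positive term [m^(n - r0 + 1)], which dominates for large [m]. *)

Set Implicit Arguments.
Unset Strict Implicit.
Unset Printing Implicit Defensive.

Import Order.TTheory GRing.Theory Num.Theory.

(** * Gains of walks and cycles, and potentials *)

Lemma next_consecutive (T : eqType) (a q : seq T) x y :
  uniq (a ++ x :: y :: q) -> next (a ++ x :: y :: q) x = y.
Proof. by move=> uc; rewrite -(next_rot (size a) uc) rot_size_cat /= eqxx. Qed.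

Lemma next_last (T : eqType) x (p : seq T) :
  uniq (x :: p) -> next (x :: p) (last x p) = x.
Proof.
move=> uc; rewrite -(next_rot (size p) uc) lastI -cats1 -(size_belast x p).
by rewrite rot_size_cat; case: p {uc} => [|y p] /=; rewrite eqxx.
Qed.

Section Gain.
Local Open Scope ring_scope.
Variables (T : finType) (V : zmodType) (s : T -> T -> V) (R : rel T).

Fixpoint gain (x : T) (p : seq T) : V :=
  if p is y :: q then s x y + gain y q else 0.

Definition cycle_gain (c : seq T) : V :=
  if c is x :: p then gain x (rcons p x) else 0.

Lemma gain_cat x p q : gain x (p ++ q) = gain x p + gain (last x p) q.
Proof. by elim: p x => [|y p IHp] x /=; rewrite ?add0r // IHp addrA. Qed.

(** For [y = x] the summands are the gains of the closed walks [x :: p] and [x :: q], so this cuts a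
    closed walk at a repeated vertex. *)
Lemma cycle_gain_split x y p q :
  cycle_gain (x :: p ++ y :: q) = gain x (rcons p y) + gain y (rcons q x).
Proof. by rewrite /= rcons_cat rcons_cons -cat_rcons gain_cat last_rcons. Qed.

Lemma cycle_split x y p q :
  cycle R (x :: p ++ y :: q) = path R x (rcons p y) && path R y (rcons q x).
Proof. by rewrite /= rcons_cat rcons_cons -cat_rcons cat_path last_rcons. Qed.

Lemma cycle_gain_rot n c : cycle_gain (rot n c) = cycle_gain c.
Proof.
rewrite /rot -{3}(cat_take_drop n c); move: (take n c) (drop n c).
case=> [|x p] [|y q] //=; rewrite ?cats0 //.
by rewrite -!/(cycle_gain (_ :: _)) !cycle_gain_split addrC.
Qed.

Lemma cycle_gain_uniq c :
  uniq c -> cycle_gain c = \sum_(x in c) s x (next c x).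
Proof.
move=> uc; rewrite -big_uniq //=; case: c uc => [|x p] uc.
  by rewrite big_nil.
set c := x :: p in uc *.
(* The induction runs over the suffixes of [c], since [next c] refers to the whole list. *)
suff gainE a z q : c = a ++ z :: q ->
    gain z (rcons q x) = \sum_(y <- z :: q) s y (next c y).
  exact: (gainE [::]).
elim: q a z => [|y q IHq] a z def_c; rewrite big_cons.
  rewrite big_nil [LHS]/=; congr (s z _ + _).
  have <- : last x p = z.
    by rewrite -[LHS]/(last x (x :: p)) -/c def_c last_cat.
  by rewrite /c next_last.
rewrite [LHS]/= (IHq (rcons a z)) ?cat_rcons //; congr (s z _ + _).
by rewrite def_c next_consecutive -?def_c.
Qed.

(** The increments of [f] along a walk telescope. *)
Lemma potential_cycle_gain (f : T -> V) :
    (forall x y, R x y -> f y = f x + s x y) ->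
  forall c, cycle R c -> cycle_gain c = 0.
Proof.
move=> fR; suff gainE x p : path R x p -> gain x p = f (last x p) - f x.
  by case=> [|x p] //= /gainE ->; rewrite last_rcons subrr.
elim: p x => [|y p IHp] x /=; first by rewrite subrr.
by case/andP=> /fR fy /IHp ->; rewrite fy addrC -addrA opprD subrK.
Qed.

(* Any two walks with the same ends can be closed up by a common return walk. *)
Lemma balanced_potential :
    symmetric R -> (forall c, cycle R c -> cycle_gain c = 0) ->
  exists f : T -> V, forall x y, R x y -> f y = f x + s x y.
Proof.
move=> symR flat; have cs : connect_sym R by apply: sym_connect_sym.
have closed x p : path R x p -> last x p = x -> gain x p = 0.
  elim/last_ind: p => // p y _; rewrite last_rcons => Rp yx.
  by rewrite -yx in Rp *; apply: (flat (y :: p)).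
have unique x p q : path R x p -> path R x q -> last x p = last x q ->
    gain x p = gain x q.
  move=> Rp Rq pq; have := connect0 R x.
  have /connectP[t Rt xt] : connect R (last x q) x.
    by rewrite cs; apply/connectP; exists q.
  move=> _; apply: (addIr (gain (last x q) t)); rewrite -{1}pq -!gain_cat.
  by rewrite !closed ?cat_path ?last_cat ?pq ?Rp ?Rq.
(* The potential at [y] will be the gain of a chosen walk from the representative of its
   component. *)
have walk y : exists p, path R (root R y) p && (last (root R y) p == y).
  have /connectP[p Rp yp] : connect R (root R y) y by rewrite cs connect_root.
  by exists p; rewrite Rp -yp eqxx.
exists (fun y => gain (root R y) (xchoose (walk y))) => x y Rxy.
have /andP[] := xchooseP (walk x); have /andP[] := xchooseP (walk y).
move: (xchoose _) (xchoose _) => p q.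
have <- : root R x = root R y by apply/(rootP cs); exact: connect1.
move=> Rq /eqP yq Rp /eqP xp.
have -> : s x y = gain (last (root R x) p) [:: y] by rewrite xp /= addr0.
rewrite -gain_cat; apply: unique => //.
  by rewrite cat_path Rp xp /= Rxy.
by rewrite last_cat /= yq.
Qed.

Definition chordless (c : seq T) : Prop :=
  {in c &, forall x y, R x y -> y = next c x \/ x = next c y}.

Lemma not_uniq_split (c : seq T) : ~~ uniq c ->
  exists x a p q, c = a ++ x :: p ++ x :: q.
Proof.
elim: c => //= x c IHc; rewrite negb_and negbK; case/orP => [|/IHc].
  by case/splitPr => p q; exists x, [::], p, q.
by case=> [y [a [p [q ->]]]]; exists y, (x :: a), p, q.
Qed.

(* A cycle of nonzero gain of minimal length: a repeated vertex or a chord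
   would split it into two shorter cycles whose gains add up to its gain. *)
Lemma chordless_unbalanced_cycle :
    symmetric R -> irreflexive R ->
    (forall x y, R x y -> s x y + s y x = 0) ->
    forall c, cycle R c -> cycle_gain c != 0 ->
  exists c', [/\ cycle R c', cycle_gain c' != 0, uniq c',
    (2 < size c')%N & chordless c'].
Proof.
move=> symR irrR sN c; have [n] := ubnP (size c).
elim: n c => // n IHn c le_cn Rc c0.
(* One of two closed walks whose gains add up to a nonzero value has nonzero gain itself. *)
have shorter c1 c2 : (size c1 < size c)%N -> (size c2 < size c)%N ->
    cycle R c1 -> cycle R c2 -> cycle_gain c = cycle_gain c1 + cycle_gain c2 ->
  exists c', [/\ cycle R c', cycle_gain c' != 0, uniq c',
    (2 < size c')%N & chordless c'].
  move=> lt1 lt2 Rc1 Rc2 ce; have [c10|c10] := eqVneq (cycle_gain c1) 0.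
    apply: (IHn c2) Rc2 _; first exact: leq_trans lt2 le_cn.
    by rewrite ce c10 add0r in c0.
  by apply: (IHn c1) Rc1 c10; apply: leq_trans lt1 le_cn.
have [uc|/not_uniq_split[x [a [p [q def_c]]]]] := boolP (uniq c); last first.
  have rc : rot (size a) c = x :: p ++ x :: (q ++ a).
    by rewrite def_c rot_size_cat /= -catA.
  apply: (shorter (x :: p) (x :: q ++ a)); rewrite -1?(size_rot (size a) c) ?rc.
  - by rewrite /= !size_cat /=; lia.
  - by rewrite /= !size_cat /= !size_cat; lia.
  - by move: Rc; rewrite -(rot_cycle (size a)) rc cycle_split => /andP[].
  - by move: Rc; rewrite -(rot_cycle (size a)) rc cycle_split => /andP[].
  - by rewrite -(cycle_gain_rot (size a)) rc cycle_gain_split.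
(* A loop contradicts irreflexivity, and going back and forth along one edge has gain zero. *)
have c2 : (2 < size c)%N.
  case: {shorter uc le_cn} c Rc c0 => [|x [|y [|z c]]] //=;
    rewrite ?eqxx ?irrR //.
  by case/andP=> Rxy _; rewrite addr0 sN // eqxx.
have [chordP|] := boolP [forall x in c, forall y in c,
    R x y ==> ((y == next c x) || (x == next c y))].
  exists c; split=> // x y xc yc Rxy; move: chordP.
  move=> /forall_inP/(_ x xc)/forall_inP/(_ y yc)/implyP/(_ Rxy).
  by case/orP=> /eqP; [left|right].
rewrite negb_forall_in => /existsP[x /andP[xc]].
rewrite negb_forall_in => /existsP[y /andP[yc]].
rewrite negb_imply negb_or => /and3P[Rxy]; have [i c1 rc] := rot_to xc.
rewrite -!(next_rot i uc) rc.
have : y \in c1.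
  have : y \in rot i c by rewrite mem_rot.
  by rewrite rc inE => /predU1P[yx|//]; rewrite yx irrR in Rxy.
move=> yc1; case/splitPr: c1 / yc1 rc => p q rc.
(* If [p] or [q] were empty, [x] and [y] would be consecutive on the cycle, not ends of a chord. *)
case: p rc => [|a p] rc; first by rewrite /= eqxx eqxx.
case: q rc => [|b q] rc.
  move: uc; rewrite -(rot_uniq i) rc => ucr _.
  have /= := next_last ucr; rewrite last_cat /= => ->.
  by rewrite eqxx.
(* The two halves are closed by the chord, traversed in opposite directions, so its contributions
   cancel. *)
move=> _ _; apply: (shorter (x :: rcons (a :: p) y) (y :: rcons (b :: q) x));
  rewrite -1?(size_rot i c) ?rc.
- by rewrite /= size_rcons size_cat /=; lia.
- by rewrite /= size_rcons size_cat /=; lia.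
- rewrite /cycle rcons_path last_rcons symR Rxy andbT.
  by move: Rc; rewrite -(rot_cycle i) rc cycle_split => /andP[].
- rewrite /cycle rcons_path last_rcons Rxy andbT.
  by move: Rc; rewrite -(rot_cycle i) rc cycle_split => /andP[].
- rewrite -(cycle_gain_rot i) rc cycle_gain_split /cycle_gain.
  rewrite -[rcons (rcons (a :: p) y) x]cats1 -[rcons (rcons (b :: q) x) y]cats1.
  rewrite !gain_cat !last_rcons [gain y [:: x]]/= [gain x [:: y]]/= !addr0.
  by rewrite [RHS]addrACA [s y x + _]addrC sN // addr0.
Qed.

End Gain.

(** * Inclusion-exclusion over edge sets *)

Lemma set2_inj (T : finType) (x y u v : T) :
  [set x; y] = [set u; v] -> x = u /\ y = v \/ x = v /\ y = u.
Proof.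
move=> xy; have := set21 x y; have := set22 x y; rewrite xy.
move=> /set2P[] yE /set2P[] xE; subst; auto.
  by have := set22 u v; rewrite -xy !inE orbb => /eqP ->; auto.
by have := set21 u v; rewrite -xy !inE orbb => /eqP ->; auto.
Qed.

Section Counting.
Local Open Scope ring_scope.

(** This expands the product of the factors [1 - [x in W]], which vanishes as soon as [W] has an
    element. *)
Lemma sum_sign_subset (T : finType) (W : {set T}) :
  \sum_(A : {set T}) (-1) ^+ #|A| * (A \subset W)%:R = (W == set0)%:R :> int.
Proof.
pose F x : int := - (x \in W)%:R.
transitivity (\prod_x (F x + 1)).
  rewrite bigA_distr; apply: eq_bigr => A _.
  rewrite -big_mkcond /= prodrN -natr_prod; congr (_ * _%:R).
  have [/subsetP AW|/subsetPn[x xA xW]] := boolP (A \subset W).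
    by rewrite big1 // => x /AW ->.
  by rewrite (bigD1 x) //= (negPf xW).
have [W0|/set0Pn[x xW]] := eqVneq W set0.
  by rewrite big1 // => x _; rewrite /F W0 inE oppr0 add0r.
by rewrite (bigD1 x) //= /F xW addNr mul0r.
Qed.

Variables (G : sgraph) (V : finZmodType).
Implicit Types (s : G -> G -> V) (A : {set {set G}}) (f : {ffun G -> V}).

(** Each edge occurs in both orders; for an antisymmetric shift on edges of [G] the two equations
    are equivalent. *)
Definition solutions s A : {set {ffun G -> V}} :=
  [set f : {ffun G -> V} |
    [forall x, forall y, ([set x; y] \in A) ==> (f y == f x + s x y)]].

Definition avoiders s : {set {ffun G -> V}} :=
  [set f : {ffun G -> V} |
    [forall x, forall y, adj x y ==> (f y != f x + s x y)]].

Lemma solutionsP s A f :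
  reflect (forall x y, [set x; y] \in A -> f y = f x + s x y)
    (f \in solutions s A).
Proof.
rewrite inE; apply: (iffP forallP) => [sP x y xyA|sP x].
  by apply/eqP; have /forallP/(_ y)/implyP := sP x; apply.
by apply/forallP => y; apply/implyP => /sP ->.
Qed.

Lemma mem_edges (x y : G) : ([set x; y] \in edges G) = adj x y.
Proof.
apply/imsetP/idP => [[[u v]]|xy]; last by exists (x, y); rewrite ?inE.
by rewrite inE /= => uv /set2_inj[] [-> ->] //; rewrite adj_sym.
Qed.

(** Translation by a particular solution is a bijection from the homogeneous solutions. *)
Lemma solutions_card s A :
  solutions s A != set0 -> #|solutions s A| = #|solutions (fun _ _ => 0%R) A|.
Proof.
case/set0Pn=> f0 /solutionsP f0P.
rewrite -[RHS](card_imset _ (addrI f0)); congr #|pred_of_set _|.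
apply/setP => f.
apply/solutionsP/imsetP => [fP|[g /solutionsP gP -> x y xyA]].
  exists (f - f0); last by rewrite addrC subrK.
  apply/solutionsP => x y xyA.
  by rewrite !ffunE (fP x y) // (f0P x y) // opprD addrACA subrr addr0.
by rewrite !ffunE (gP x y) // addr0 (f0P x y) // addrAC.
Qed.

Definition antisymmetric_shift s : Prop :=
  forall x y, adj x y -> s x y + s y x = 0.

(** Let [W] be the set of edges whose equation [f] satisfies. Then [f] avoids all of them iff [W] is
    empty, and solves [A] iff [A] lies in [W], so [sum_sign_subset] applies. *)
Lemma avoiders_sum s f : antisymmetric_shift s ->
  (f \in avoiders s)%:R =
    \sum_(A : {set {set G}} | A \subset edges G)
      (-1) ^+ #|A| * (f \in solutions s A)%:R :> int.
Proof.
move=> sN; pose W := [set e in edges G | f \in solutions s [set e]].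
have -> : (f \in avoiders s) = (W == set0).
  rewrite inE; apply/forallP/eqP => [fP|W0 x].
    apply/setP => e; rewrite !inE; apply/negP => /andP[/imsetP[[x y]]].
    rewrite inE /= => xy -> /forallP/(_ x)/forallP/(_ y).
    rewrite inE eqxx /=; apply/negP.
    by have /forallP/(_ y)/implyP := fP x; apply.
  apply/forallP => y; apply/implyP => xy; apply/negP => /eqP fxy.
  have := in_set0 [set x; y]; rewrite -W0 inE mem_edges xy /=.
  move=> /negP; apply; apply/solutionsP => u v; rewrite inE => /eqP /set2_inj.
  case=> [] [-> ->] //; rewrite fxy -addrA sN ?addr0 //.
rewrite -sum_sign_subset [RHS]big_mkcond; apply: eq_bigr => A _.
case: ifP => AE; last first.
  suff /negPf -> : ~~ (A \subset W) by rewrite mulr0.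
  apply: contraFN AE => /subset_trans; apply.
  by apply/subsetP => e; rewrite inE => /andP[].
congr (_ * (nat_of_bool _)%:R);
apply/subsetP/solutionsP => [AW x y xyA|fP e eA].
  have /AW := xyA; rewrite inE => /andP[_ /solutionsP]; apply.
  exact: set11.
rewrite inE (subsetP AE) //=; apply/solutionsP => x y; rewrite inE => /eqP xye.
by apply: fP; rewrite xye.
Qed.

Lemma card_avoiders s : antisymmetric_shift s ->
  #|avoiders s|%:R =
    \sum_(A : {set {set G}} | A \subset edges G)
      (-1) ^+ #|A| * #|solutions s A|%:R :> int.
Proof.
move=> sN; rewrite -sum1_card natr_sum big_mkcond /=.
transitivity (\sum_f \sum_(A : {set {set G}} | A \subset edges G)
    (-1) ^+ #|A| * (f \in solutions s A)%:R : int).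
  by apply: eq_bigr => f _; rewrite -avoiders_sum //; case: ifP.
rewrite exchange_big; apply: eq_bigr => A _; rewrite -mulr_sumr; congr (_ * _).
rewrite -sum1_card natr_sum [RHS]big_mkcond.
by apply: eq_bigr => f _; case: ifP.
Qed.

(* Inclusion-exclusion over the edge sets. The solution sets of a satisfiable
   system are translates of those of the homogeneous one, so only the edge sets
   with no solutions contribute to the difference. *)
Lemma fewer_avoiders s (C : {set {set G}}) k :
    antisymmetric_shift s ->
    C \subset edges G -> ~~ odd #|C| -> solutions s C = set0 ->
    (#|V| ^ k.+1 <= #|solutions (fun _ _ => 0%R) C|)%N ->
    (forall A, A \subset edges G -> odd #|A| -> solutions s A = set0 ->
      #|solutions (fun _ _ => 0%R) A| <= #|V| ^ k)%N ->
    (2 ^ #|edges G| < #|V|)%N ->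
  (#|avoiders s| < #|avoiders (fun _ _ => 0%R)|)%N.
Proof.
move=> sN CE Ceven C0 Ck Ak Vbig.
pose d A : int := (-1) ^+ #|A| *
  (#|solutions (fun _ _ => 0%R) A|%:R - #|solutions s A|%:R).
have dE : #|avoiders (fun _ _ => 0%R)|%:R - #|avoiders s|%:R =
    \sum_(A : {set {set G}} | A \subset edges G) d A :> int.
  rewrite !card_avoiders //; last by move=> x y _; rewrite addr0.
  by rewrite -sumrB; apply: eq_bigr => A _; rewrite -mulrBr.
(* The term is zero for a solvable system and nonnegative for even [#|A|]; only odd unsolvable sets
   need the hypothesis. *)
have d_ge A : A \subset edges G -> - (#|V| ^ k)%:R <= d A.
  move=> AE; rewrite /d.
  have [A0|A0] := eqVneq (solutions s A) set0; last first.
    by rewrite solutions_card // subrr mulr0 oppr_le0.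
  rewrite A0 cards0 subr0 -signr_odd.
  case: (boolP (odd #|A|)) => oA; last first.
    by rewrite mul1r (@le_trans _ _ 0) // oppr_le0.
  by rewrite mulN1r lerN2 ler_nat Ak.
have dC : (#|V| ^ k.+1)%:R <= d C.
  by rewrite /d C0 cards0 subr0 -signr_odd (negPf Ceven) mul1r ler_nat.
suff : 0 < #|avoiders (fun _ _ => 0%R)|%:R - #|avoiders s|%:R :> int.
  by rewrite subr_gt0 ltr_nat.
rewrite dE (bigD1 C) //=.
(* There are at most [2 ^ #|edges G|] other terms, and this number is below [#|V|], so [C] outweighs
   them. *)
have rest : - ((2 ^ #|edges G|) * #|V| ^ k)%:R <=
    \sum_(A : {set {set G}} | (A \subset edges G) && (A != C)) d A.
  apply: (@le_trans _ _ (\sum_(A : {set {set G}} |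
      (A \subset edges G) && (A != C)) - (#|V| ^ k)%:R)).
    rewrite (eq_bigl (mem (powerset (edges G) :\ C))); last first.
      by move=> A; rewrite /= !inE andbC.
    rewrite sumr_const mulNrn lerN2 -[leLHS]mulr_natr -natrM ler_nat mulnC.
    rewrite leq_mul2r -card_powerset subset_leq_card ?orbT //.
    exact: subsetDl.
  by apply: ler_sum => A /andP[AE _]; apply: d_ge.
apply: lt_le_trans (lerD dC rest).
rewrite subr_gt0 ltr_nat expnS ltn_mul2r Vbig andbT expn_gt0.
by rewrite (leq_ltn_trans _ Vbig).
Qed.

End Counting.

(** * Unsolvable systems and the number of homogeneous solutions *)

Section Cycles.
Variable G : sgraph.
Implicit Types (c : seq G) (A : {set {set G}}).

Lemma is_cycle_uniq c : is_cycle c -> uniq c.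
Proof. by case/and3P. Qed.

(** Distinct vertices yielding the same edge would be successors of each other, which forces length
    two. *)
Lemma next_edge_inj c : is_cycle c ->
  {in c &, injective (fun x => [set x; next c x])}.
Proof.
case/and3P=> c3 _ uc x y xc yc /set2_inj[[//]|[xE yE]].
have [i p rc] := rot_to xc; move: yE xE c3 (uc).
rewrite -!(next_rot i uc) -(size_rot i) -(rot_uniq i) rc.
case: p {rc} => [|b [|d p]] //=; rewrite eqxx => <- /=.
rewrite eqxx; case: eqP => [->|_]; first by rewrite mem_head.
by move=> -> _; rewrite !inE eqxx !orbT.
Qed.

Lemma card_cycle_edges c : is_cycle c -> #|cycle_edges c| = size c.
Proof.
move=> cc; rewrite card_in_imset ?(card_uniqP (is_cycle_uniq cc)) //.
exact: next_edge_inj.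
Qed.

Lemma cycle_edges_sub c : is_cycle c -> cycle_edges c \subset edges G.
Proof.
case/and3P=> _ cc _; apply/subsetP=> _ /imsetP[x xc ->].
by rewrite mem_edges (next_cycle cc).
Qed.

Lemma mem_cycle_edges c x y :
  [set x; y] \in cycle_edges c -> (x \in c) && (y \in c).
Proof.
by case/imsetP=> z zc /set2_inj[] [-> ->]; rewrite mem_next zc.
Qed.

Variable V : finZmodType.
Implicit Types (s : G -> G -> V) (f g : {ffun G -> V}).

(** If all cycles in [A] had gain zero, a potential would solve the system; otherwise a chordless
    unbalanced cycle exists. *)
Lemma unsolvable_cycle s A : A \subset edges G -> antisymmetric_shift s ->
    solutions s A = set0 ->
  exists c, [/\ is_cycle c, cycle_edges c \subset A, cycle_gain s c != 0%R &
    {in c &, forall x y, [set x; y] \in A -> [set x; y] \in cycle_edges c}].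
Proof.
move=> AE sN A0; pose R : rel G := fun x y => [set x; y] \in A.
have Radj x y : R x y -> adj x y by move/(subsetP AE); rewrite mem_edges.
have symR : symmetric R by move=> x y; rewrite /R setUC.
have irrR : irreflexive R by move=> x; apply/negP => /Radj; rewrite adj_irrefl.
have [[c [Rc c0]]|flat] :=
  pselect (exists c, cycle R c /\ cycle_gain s c != 0%R).
  have sNR x y : R x y -> (s x y + s y x = 0)%R by move/Radj/sN.
  have [c' [Rc' gc' uc' c'3 chc']] :=
    chordless_unbalanced_cycle symR irrR sNR Rc c0.
  exists c'; split=> //.
    by rewrite /is_cycle c'3 /ucycleb uc' (sub_cycle Radj).
    by apply/subsetP=> _ /imsetP[x xc ->]; apply: (next_cycle Rc').
  move=> x y xc yc Rxy; apply/imsetP.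
  have [yE|xE] := chc' x y xc yc Rxy; first by exists x; rewrite // -yE.
  by exists y; rewrite // -xE setUC.
have [c Rc|f fP] := @balanced_potential _ _ s R symR.
  by apply/eqP/negPn/negP => c0; apply: flat; exists c.
have : [ffun x => f x] \in solutions s A.
  by apply/solutionsP => x y; rewrite !ffunE; exact: fP.
by rewrite A0 inE.
Qed.

Local Notation homogeneous A := (solutions (fun _ _ => 0%R : V) A).

Lemma homogeneousP A f :
  reflect (forall x y, [set x; y] \in A -> f x = f y) (f \in homogeneous A).
Proof.
by apply: (iffP (solutionsP _ _ _)) => fP x y /fP; rewrite addr0 => ->.
Qed.

Lemma homogeneous_cycle A c f : is_cycle c -> cycle_edges c \subset A ->
  f \in homogeneous A -> {in c &, forall x y, f x = f y}.
Proof.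
case/and3P=> _ _ uc cA /homogeneousP fP.
have fc : cycle [rel x y | f x == f y] c.
  apply: cycle_from_next => // x xc; apply/eqP/fP.
  by apply: (subsetP cA); apply/imsetP; exists x.
rewrite cycle_all2rel in fc; last by move=> x y z /= /eqP -> /eqP ->.
move=> x y xc yc; apply/eqP; exact: (allrelP fc).
Qed.

Lemma card_homogeneous_le A (D : {set G}) :
    {in homogeneous A &, forall f g, {in D, f =1 g} -> f = g} ->
  #|homogeneous A| <= #|V| ^ #|D|.
Proof.
(* Putting zero outside [D] turns restrictions to [D] into maps supported in [D], which are easily
   counted. *)
move=> det; pose h f := [ffun x => if x \in D then f x else 0%R].
have hinj : {in homogeneous A &, injective h}.
  move=> f g fA gA fg; apply: det => // x xD.
  by have /ffunP/(_ x) := fg; rewrite !ffunE xD.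
rewrite -(card_in_imset hinj) -(card_pffun_on 0%R (mem D) (mem V)).
apply/subset_leq_card/subsetP => _ /imsetP[f _ ->]; apply/pffun_onP; split=> //.
by apply/supportP => x xD; rewrite ffunE (negPf xD).
Qed.

(** The values off the cycle and at its head, which accounts for the successor in the exponent, are
    free; the head value is copied around the cycle. *)
Lemma card_homogeneous_cycle c : is_cycle c ->
  #|V| ^ (#|G| - size c).+1 <= #|homogeneous (cycle_edges c)|.
Proof.
case: c => // x p cc; set c := x :: p in cc *.
have uc := is_cycle_uniq cc.
pose D := ~: [set y in p].
have xD : x \in D by move: uc; rewrite !inE => /andP[].
have <- : #|D| = (#|G| - size c).+1.
  have up : uniq p by case/andP: uc.
  have le_cG : size c <= #|G| by rewrite -(card_uniqP uc) max_card.
  by rewrite cardsCs setCK cardsE (card_uniqP up); move: le_cG => /=; lia.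
rewrite -(card_pffun_on 0%R (mem D) (mem V)).
pose h f := [ffun y => if y \in c then f x else f y].
have hinj : {in pffun_on 0%R (mem D) (mem V) &, injective h}.
  move=> f g /pffun_onP[/supportP fD _] /pffun_onP[/supportP gD _] /ffunP fg.
  apply/ffunP => y; have [yD|yD] := boolP (y \in D); last by rewrite fD ?gD.
  have := fg y; rewrite !ffunE inE; case: eqVneq => [-> //|_] /=.
  by move: yD; rewrite !inE => /negPf ->.
rewrite -(card_in_imset hinj).
apply/subset_leq_card/subsetP => _ /imsetP[f _ ->]; apply/homogeneousP => y z.
by case/mem_cycle_edges/andP => yc zc; rewrite !ffunE yc zc.
Qed.

(* The shortest unbalanced cycle is induced, so if it is not longer than [r]
   then parity provides an edge of [A] that leaves it. *)
Lemma card_homogeneous_odd s A r : A \subset edges G -> antisymmetric_shift s ->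
    (forall c, is_cycle c -> size c < r -> cycle_gain s c = 0%R) ->
    ~~ odd r -> odd #|A| -> solutions s A = set0 ->
  #|homogeneous A| <= #|V| ^ (#|G| - r).
Proof.
move=> AE sN short r_even A_odd A0.
have [c [cc cA gc chord]] := unsolvable_cycle AE sN A0.
have le_rc : r <= size c.
  by rewrite leqNgt; apply: contra gc => /short ->.
have uc := is_cycle_uniq cc.
have V0 : 0 < #|V| by apply/card_gt0P; exists 0%R.
case: c => [|x p] // in cc cA gc chord le_rc uc *.
set c := x :: p in cc cA chord uc.
have [xp up] := andP uc.
have xc : x \in c by exact: mem_head.
suff [D Dr Ddet] : exists2 D : {set G}, #|D| <= #|G| - r &
    {in homogeneous A &, forall f g, {in D, f =1 g} -> f = g}.
  by apply: leq_trans (card_homogeneous_le Ddet) _; rewrite leq_pexp2l.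
(* On a cycle longer than [r] the head determines at least [r] other vertices. *)
have [lt_rc|le_cr] := ltnP r (size c).
  exists (~: [set y in p]).
    by rewrite cardsCs setCK cardsE (card_uniqP up) leq_sub2l.
  move=> f g fA gA fg; apply/ffunP => y.
  have fgx : f x = g x by apply: fg; rewrite !inE.
  have [yp|yp] := boolP (y \in p); last by apply: fg; rewrite !inE.
  have yc : y \in c by rewrite inE yp orbT.
  by rewrite (homogeneous_cycle cc cA fA yc xc)
    (homogeneous_cycle cc cA gA yc xc).
have rE : r = (size p).+1 by apply/eqP; rewrite eqn_leq le_rc.
(* Here [size c = r] is even while [#|A|] is odd, so [A] is not just the cycle. *)
have [e eA ec] : exists2 e, e \in A & e \notin cycle_edges c.
  apply/subsetPn; apply: contraL A_odd => Ac.
  have -> : A = cycle_edges c by apply/eqP; rewrite eqEsubset Ac cA.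
  by rewrite card_cycle_edges // -[size c]/(size p).+1 -rE.
(* The extra edge is not a chord, so it has an end [u] off the cycle. *)
have [u [v [uvA uc']]] : exists u v, [set u; v] \in A /\ u \notin c.
  have /imsetP[[u v] _ /= eE] := subsetP AE _ eA; rewrite eE in eA ec.
  have [uc'|uc'] := boolP (u \in c); last by exists u, v.
  have [vc|vc] := boolP (v \in c); last by exists v, u; rewrite setUC.
  by rewrite chord in ec.
have uv : u != v.
  move: (subsetP AE _ uvA); rewrite mem_edges.
  by apply: contraTneq => ->; rewrite adj_irrefl.
move: (uc'); rewrite inE negb_or => /andP[ux up'].
(* The value at [u] equals that at [v], which is on the cycle or in this set; dropping [u] saves the
   missing factor [#|V|]. *)
exists (~: (u |: [set y in p])).
  by rewrite cardsCs setCK cardsU1 inE up' cardsE (card_uniqP up) rE.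
move=> f g fA gA fg; apply/ffunP => y.
have fgc : {in c, f =1 g}.
  move=> z zc; rewrite (homogeneous_cycle cc cA fA zc xc)
    (homogeneous_cycle cc cA gA zc xc).
  by apply: fg; rewrite !inE negb_or eq_sym ux.
have [yc|yc] := boolP (y \in c); first exact: fgc.
have fgD z : z \notin c -> z != u -> f z = g z.
  rewrite inE negb_or => /andP[_ zp] zu; apply: fg; rewrite !inE negb_or zu //.
have [->|yu] := eqVneq y u; last exact: fgD.
rewrite (homogeneousP _ _ fA u v uvA) (homogeneousP _ _ gA u v uvA).
have [vc|vc] := boolP (v \in c); first exact: fgc.
by apply: fgD; rewrite // eq_sym.
Qed.

End Cycles.

(** * The shift defined by an orientation *)

Section OrientationShift.
Local Open Scope ring_scope.
Variables (G : sgraph) (V : zmodType) (a : V).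
Variables (E : {set {set G}}) (o : {set G} -> G * G).
Hypothesis oE : orientation E o.

Definition orientation_shift (x y : G) : V :=
  if [set x; y] \in E then if o [set x; y] == (x, y) then a else - a else 0.

Lemma orientation_shiftN x y :
  adj x y -> orientation_shift x y + orientation_shift y x = 0.
Proof.
move=> xy; rewrite /orientation_shift [ [set y; x] ]setUC.
case: ifP => [xyE|_]; last by rewrite addr0.
have neq_xy : x != y by apply: contraTneq xy => ->; rewrite adj_irrefl.
have := oE xyE; case: (o _) => u v /= /set2_inj[] [-> ->].
  by rewrite eqxx xpair_eqE (negPf neq_xy) subrr.
by rewrite eqxx xpair_eqE eq_sym (negPf neq_xy) addNr.
Qed.

Lemma forward_edges_sub c : forward_edges E o c \subset cycle_edges c :&: E.
Proof. by apply/subsetP => e; rewrite inE => /andP[]. Qed.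

Lemma cycle_gain_orientation c : is_cycle c ->
  cycle_gain orientation_shift c =
    a *+ #|forward_edges E o c|
      - a *+ (#|cycle_edges c :&: E| - #|forward_edges E o c|).
Proof.
move=> cc; set F := forward_edges E o c.
have FE := forward_edges_sub c; rewrite -/F in FE.
pose B := (cycle_edges c :&: E) :\: F.
have -> : (#|cycle_edges c :&: E| - #|F|)%N = #|B|.
  by rewrite cardsD (setIidPr FE).
rewrite cycle_gain_uniq ?is_cycle_uniq //.
transitivity (\sum_(e in cycle_edges c) (a *+ (e \in F) - a *+ (e \in B))).
  rewrite big_imset /=; last exact: next_edge_inj.
  apply: eq_bigr => x xc; rewrite /orientation_shift in_setD in_setI.
  set e := [set x; next c x].
  have -> /= : e \in cycle_edges c by apply/imsetP; exists x.
  (* The existential in [forward_edges] can only be witnessed by [x], by [next_edge_inj]. *)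
  have -> : (e \in F) = (e \in E) && (o e == (x, next c x)).
    rewrite !inE; have -> /= : e \in cycle_edges c by apply/imsetP; exists x.
    case: (boolP (e \in E)) => //= eE.
    apply/existsP/idP => [[y /andP[yc /eqP oy]]|ox].
      have := oE eE; rewrite oy /= => /(next_edge_inj cc yc xc) yx.
      by rewrite yx.
    by exists x; rewrite xc.
  by case: (e \in E) => /=; case: (o e == _); rewrite ?subr0 ?sub0r.
have sumD (D : {set {set G}}) : D \subset cycle_edges c ->
    \sum_(e in cycle_edges c) a *+ (e \in D) = a *+ #|D|.
  move=> Dc; rewrite sumrMnr; congr (_ *+ _).
  rewrite -sum1_card [RHS]big_mkcond [LHS]big_mkcond /=; apply: eq_bigr => e _.
  case: (boolP (e \in D)) => [/(subsetP Dc) -> //|_]; by case: ifP.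
have Ec : cycle_edges c :&: E \subset cycle_edges c by apply: subsetIl.
rewrite sumrB !sumD //; last exact: subset_trans FE Ec.
by apply: subset_trans Ec; apply: subsetDl.
Qed.

Lemma balanced_cycle_gain c : is_cycle c -> balanced E o c ->
  cycle_gain orientation_shift c = 0.
Proof.
move=> cc /andP[even /eqP half]; rewrite cycle_gain_orientation // half.
set n := #|_| in even *; suff -> : (n - n./2)%N = n./2 by rewrite subrr.
by rewrite -{1}(even_halfK even) -addnn addnK.
Qed.

(** The numbers of forward and backward edges have an odd sum, hence differ; both are at most
    [#|G|], so these multiples of [a] differ too. *)
Lemma odd_cycle_gain c : is_cycle c -> odd #|cycle_edges c :&: E| ->
    {in [pred i : nat | i <= #|G|]%N &, injective (GRing.natmul a)} ->
  cycle_gain orientation_shift c != 0.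
Proof.
move=> cc oddE ainj; rewrite cycle_gain_orientation // subr_eq0.
have cE : (#|cycle_edges c :&: E| <= #|G|)%N.
  apply: leq_trans (subset_leq_card (subsetIl _ _)) _.
  by rewrite card_cycle_edges // -(card_uniqP (is_cycle_uniq cc)) max_card.
have FE := subset_leq_card (forward_edges_sub c).
apply/eqP => /ainj; rewrite !inE => eqF.
suff : odd (#|forward_edges E o c| + #|forward_edges E o c|).
  by rewrite addnn odd_double.
rewrite {2}eqF ?subnKC //; first exact: leq_trans cE.
by apply: leq_trans cE; apply: leq_subr.
Qed.

End OrientationShift.

(** * The cover defined by a shift *)

Section ShiftCover.
Variables (G : sgraph) (V : finZmodType) (s : G -> G -> V).
Hypothesis sN : antisymmetric_shift s.

Definition shift_adj : rel (G * V) := fun p q =>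
  (p.1 == q.1) && (p != q) || adj p.1 q.1 && (q.2 == p.2 + s p.1 q.1)%R.

Lemma shift_adj_sym : symmetric shift_adj.
Proof.
move=> p q; rewrite /shift_adj eq_sym [p == q]eq_sym adj_sym; congr (_ || _).
case: (boolP (adj q.1 p.1)) => //= /sN qp.
apply/eqP/eqP => ->; rewrite -addrA ?qp ?addr0 //.
by rewrite [(s p.1 _ + _)%R]addrC qp addr0.
Qed.

Lemma shift_adj_irrefl : irreflexive shift_adj.
Proof. by move=> p; rewrite /shift_adj !eqxx adj_irrefl. Qed.

Definition shift_graph : sgraph := SGraph shift_adj_sym shift_adj_irrefl.

Definition shift_fibre (u : G) : {set shift_graph} :=
  [set p : G * V | p.1 == u].

(** Between adjacent fibres the edges form the graph of a translation, whose injectivity gives the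
    matching condition. *)
Lemma shift_fold_cover : is_fold_cover #|V| shift_fibre.
Proof.
split; first split.
- move=> p; exists p.1; split; first by rewrite inE.
  by move=> u; rewrite inE => /eqP.
- move=> u p q; rewrite !inE => /eqP pu /eqP qu neq_pq.
  by rewrite /adj /= /shift_adj pu qu eqxx neq_pq.
- move=> u v neq_uv not_uv; apply/setP => e; rewrite inE; apply/negP.
  case/imsetP=> -[p q]; rewrite inE /= !inE => /and3P[/eqP pu /eqP qv].
  by rewrite /adj /= /shift_adj pu qv (negPf neq_uv) (negPf not_uv).
- move=> u v uv; have neq_uv : u != v.
    by apply: contraTneq uv => ->; rewrite adj_irrefl.
  have edgeE e : e \in edges_between (shift_fibre u) (shift_fibre v) ->
      exists i, e = [set (u, i); (v, i + s u v)%R].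
    case/imsetP=> -[[u' i] [v' j]]; rewrite inE /= !inE /=.
    case/and3P=> /eqP -> /eqP ->.
    rewrite /adj /= /shift_adj /= (negPf neq_uv) uv /= => /eqP -> ->.
    by exists i.
  apply/trivIsetP => e e' /edgeE[i ->] /edgeE[j ->] ij.
  have {}ij : i != j by apply: contraNneq ij => ->.
  rewrite disjoint_subset; apply/subsetP => p; rewrite !inE.
  case/orP=> /eqP ->; rewrite !xpair_eqE eqxx.
    by rewrite (negPf neq_uv) (negPf ij).
  by rewrite eq_sym (negPf neq_uv) (inj_eq (addIr _)) (negPf ij).
- move=> u; have -> : shift_fibre u = setX [set u] [set: V].
    by apply/setP => -[v i]; rewrite !inE /= andbT.
  by rewrite cardsX cards1 cardsT mul1n.
Qed.

(** Fibres are cliques, so an independent set of size [#|G|] meets each exactly once and is the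
    graph of a map, which avoids the shift. *)
Lemma num_shift_colorings : num_cover_colorings G shift_graph <= #|avoiders s|.
Proof.
pose graph f : {set shift_graph} := [set p : G * V | p.2 == f p.1].
apply: leq_trans (leq_imset_card (fun f : {ffun G -> V} => graph f) _).
apply/subset_leq_card/subsetP => I; rewrite inE => /andP[indI cardI].
have indep p q : p \in I -> q \in I -> ~~ shift_adj p q.
  by move=> pI qI; have /forall_inP/(_ p pI)/forall_inP/(_ q qI) := indI.
have inj1 : {in I &, injective fst}.
  move=> p q pI qI pq; apply/eqP; have := indep p q pI qI.
  by rewrite /shift_adj pq eqxx /= negb_or negbK => /andP[].
have full : [set p.1 | p in I] = [set: G].
  by apply/eqP; rewrite eqEcard subsetT cardsT card_in_imset // (eqP cardI) /=.
have ex u : exists i, (u, i) \in I.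
  have : u \in [set p.1 | p in I] by rewrite full.
  by case/imsetP=> -[u' i] pI /= ->; exists i.
pose f := [ffun u => xchoose (ex u)].
have fI u : (u, f u) \in I by rewrite ffunE; exact: (xchooseP (ex u)).
apply/imsetP; exists f.
  rewrite inE; apply/forallP => x; apply/forallP => y; apply/implyP => xy.
  have := indep _ _ (fI x) (fI y); rewrite /shift_adj /= xy negb_or => /andP[_].
  by [].
apply/setP => -[u i]; rewrite inE /=; apply/idP/eqP => [uI|->]; last exact: fI.
by have [] := inj1 _ _ uI (fI u) erefl.
Qed.

End ShiftCover.

(** * Comparison of the two color functions *)

Lemma dp_color_function_le (G H : sgraph) (L : G -> {set H}) m :
  is_fold_cover m L -> dp_color_function G m <= num_cover_colorings G H.
Proof.
move=> HL; rewrite /dp_color_function; case: ex_minnP => n _; apply.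
by apply/asboolP; exists H, L.
Qed.

Lemma chromatic_poly_avoiders (G : sgraph) m :
  chromatic_poly G m.+1 = #|avoiders (fun _ _ : G => 0%R : 'I_m.+1)|.
Proof.
apply: eq_card => f; rewrite !inE.
apply: eq_forallb => x; apply: eq_forallb => y.
by rewrite addr0 eq_sym.
Qed.

Theorem theorem1p4 (G : sgraph) (E : {set {set G}}) (r0 : nat)
  (G_connected : connected G)
  (E_edges : E \subset edges G)
  (girth_E : girth E = Some r0)
  (r0_even : ~~ odd r0)
  (E_balanced : exists o : {set G} -> G * G,
     orientation E o /\
     forall c : seq G, is_cycle c -> #|cycle_edges c| < r0 -> balanced E o c) :
  DP_lt G.
Proof.
have [o [oE short]] := E_balanced.
have [c [cc c_odd cr]] : exists c : seq G,
    [/\ is_cycle c, odd #|cycle_edges c :&: E| & size c = r0].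
  move: girth_E; rewrite /girth; case: pselect => // ex_k [<-].
  case: ex_minnP => k /existsP[t /andP[ct t_odd]] _.
  by exists t; rewrite size_tuple.
(* The modulus must exceed [2 ^ #|edges G|] for the counting and [#|G|] for small multiples of [1]
   to stay distinct; the [+ 2] excludes moduli 0 and 1. *)
exists (maxn (2 ^ #|edges G|) #|G| + 2) => -[|[|m]] m_ge;
  try by rewrite addn2 in m_ge.
pose V : finZmodType := 'I_m.+2; pose s := orientation_shift (1%R : V) E o.
have cardV : #|V| = m.+2 by exact: card_ord.
have sN : antisymmetric_shift s by apply: orientation_shiftN.
rewrite chromatic_poly_avoiders.
apply: (@leq_ltn_trans #|avoiders s|).
  apply: leq_trans (num_shift_colorings sN).
  by apply: dp_color_function_le; rewrite -{1}cardV; apply: shift_fold_cover.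
apply: (@fewer_avoiders _ _ s (cycle_edges c) (#|G| - r0)) => //.
- exact: cycle_edges_sub.
- by rewrite card_cycle_edges // cr.
(* A solution would be a potential along [c], whose gain is nonzero as [c] has an odd number of
   edges in [E]. *)
- apply/eqP; rewrite -[_ == _]negbK; apply/negP => /set0Pn[f /solutionsP fP].
  have /negP[] : cycle_gain s c != 0%R.
    apply: odd_cycle_gain => // i j; rewrite !inE => iG jG.
    rewrite !Zp_nat => /(congr1 val) /=.
    by rewrite !modn_small //; move: m_ge; lia.
  apply/eqP/(potential_cycle_gain fP).
  apply: cycle_from_next => [|x xc]; first exact: is_cycle_uniq.
  by apply/imsetP; exists x.
- by rewrite -cr; apply: card_homogeneous_cycle.
- move=> A AE A_odd A0; apply: (card_homogeneous_odd AE sN) => //.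
  move=> d dc dr; apply: balanced_cycle_gain => //; apply: short => //.
  by rewrite card_cycle_edges.
- by rewrite cardV; move: m_ge; lia.
Qed.
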